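(* Assume that $\mathcal K_{js}$ is nonempty, that the sublevel set $\mathcal K_{js,\gamma}$ is compact, and that $J_{SA}$ is continuously differentiable and $L$-smooth on $\mathcal K_{js,\gamma}$ for some $L>0$. Let $\{K_i\}_{i\ge0}$ be iterates of the policy iteration lying in $\mathcal K_{js,\gamma}$, with update directions $\Delta_i$ satisfying $\sup_{i\ge0}\|\Delta_i\|_F<\infty$, and let $\bar\alpha>0$ be a constant such that $K_i+a\Delta_i\in\mathcal K_{js}$ for every $i\ge0$ and every $a\in[0,\bar\alpha]$. Let $c_d>0$ be a constant such that $\langle\nabla J_{SA}(K_i),\Delta_i\rangle\le -c_d\|\Delta_i\|_F^2$ for every $i\ge 0$. If $\Delta_i\neq0$ and $0<\alpha\le\min\{\bar\alpha,\,c_d/L\}$, then $$J_{SA}(K_i+\alpha\Delta_i)<J_{SA}(K_i).$$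
   Context: Let $M\ge 1$, $[M]=\{1,\dots,M\}$, and let $(A_j,B_j)$, $j\in[M]$, be given (sampled) system matrices with $A_j\in\mathbb{R}^{n\times n}$, $B_j\in\mathbb{R}^{n\times m}$. Let $Q\in\mathbb{R}^{n\times n}$ be symmetric with $Q\succeq 0$ and $R\in\mathbb{R}^{m\times m}$ symmetric with $R\succ 0$. $\rho(\cdot)$ denotes the spectral radius, $\langle\cdot,\cdot\rangle$ the Frobenius inner product and $\|\cdot\|_F$ the Frobenius norm. Define $$\mathcal K_{js}=\{K\in\mathbb{R}^{m\times n}:\rho(A_j+B_jK)<1\ \ \forall j\in[M]\}.$$ For $K\in\mathcal K_{js}$ let $P_j(K)$, $\Sigma_j(K)$ be the unique solutions of $$P_j=Q+K^\top RK+(A_j+B_jK)^\top P_j(A_j+B_jK),$$ $$\Sigma_j=I+(A_j+B_jK)\Sigma_j(A_j+B_jK)^\top .$$ The sample-average objective is $J_{SA}(K)=\frac1M\sum_{j=1}^M\mathrm{Tr}\big((Q+K^\top RK)\Sigma_j(K)\big)$ for $K\in\mathcal K_{js}$. For a fixed finite $\gamma$, $\mathcal K_{js,\gamma}=\{K\in\mathcal K_{js}:J_{SA}(K)\le\gamma\}$. ''$L$-smooth on $\mathcal K_{js,\gamma}$'' means that $\nabla J_{SA}$ is $L$-Lipschitz in the Frobenius norm on $\mathcal K_{js,\gamma}$. Policy iteration: given $K_i\in\mathcal K_{js}$, put $P_{j,i}=P_j(K_i)$, $\Sigma_{j,i}=\Sigma_j(K_i)$; $\widehat K_{i+1}$ is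 the unique solution of $$\sum_{j=1}^M\Big[(R+B_j^\top P_{j,i}B_j)\widehat K_{i+1}+B_j^\top P_{j,i}A_j\Big]\Sigma_{j,i}=0,$$ the update direction is $\Delta_i:=\widehat K_{i+1}-K_i$, and the next iterate is obtained by adding to $K_i$ a positive step size times $\Delta_i$. *)

(* Defs.v *)
From mathcomp Require Import all_boot all_order all_algebra.
From mathcomp Require Import complex.
From mathcomp Require Import all_classical all_reals all_analysis.

Set Implicit Arguments.
Unset Strict Implicit.
Unset Printing Implicit Defensive.

Import Order.TTheory GRing.Theory Num.Theory.
Import numFieldNormedType.Exports.

Local Open Scope classical_set_scope.
Local Open Scope ring_scope.

Definition possemidef (R : realType) (n : nat) (Q : 'M[R]_n) : Prop :=
  Q^T = Q /\ forall x : 'cV[R]_n, 0 <= (x^T *m Q *m x) 0 0.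

Definition posdef (R : realType) (n : nat) (Q : 'M[R]_n) : Prop :=
  Q^T = Q /\ forall x : 'cV[R]_n, x != 0 -> 0 < (x^T *m Q *m x) 0 0.

Definition frobenius_dot (R : realType) (m n : nat) (X Y : 'M[R]_(m, n)) : R :=
  \tr (X^T *m Y).

(* The library norm `|X| on matrices is the max norm, not this one. *)
Definition frobenius_norm (R : realType) (m n : nat) (X : 'M[R]_(m, n)) : R :=
  Num.sqrt (frobenius_dot X X).

(* The eigenvalues are the complex ones of the real matrix A. *)
Definition spectral_radius (R : realType) (n : nat) (A : 'M[R]_n) : R :=
  sup [set Normc.normc z | z in
         [set z : R[i] | eigenvalue (map_mx (real_complex R) A) z]].

(* Gradient for the Frobenius inner product: the matrix of partial
   derivatives. *)
Definition gradient (R : realType) (m n : nat) (f : 'M[R]_(m, n) -> R)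
    (K : 'M[R]_(m, n)) : 'M[R]_(m, n) :=
  \matrix_(i < m, j < n) 'D_(delta_mx i j) f K.

Definition continuously_differentiable_on (R : realType) (m n : nat)
    (f : 'M[R]_(m, n) -> R) (D : set 'M[R]_(m, n)) : Prop :=
  (forall K, D K -> differentiable f K) /\
  {within D, continuous (gradient f)}.

Definition smooth_on (R : realType) (m n : nat) (L : R)
    (f : 'M[R]_(m, n) -> R) (D : set 'M[R]_(m, n)) : Prop :=
  forall K K', D K -> D K' ->
    frobenius_norm (gradient f K - gradient f K') <=
    L * frobenius_norm (K - K').

Definition closed_loop (R : realType) (n m : nat)
    (A : 'M[R]_n) (B : 'M[R]_(n, m)) (K : 'M[R]_(m, n)) : 'M[R]_n :=
  A + B *m K.

Definition jointly_stabilizing (R : realType) (M n m : nat)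
    (A : 'I_M -> 'M[R]_n) (B : 'I_M -> 'M[R]_(n, m)) : set 'M[R]_(m, n) :=
  [set K | forall j, spectral_radius (closed_loop (A j) (B j) K) < 1].

Definition stage_cost (R : realType) (n m : nat)
    (Q : 'M[R]_n) (S : 'M[R]_m) (K : 'M[R]_(m, n)) : 'M[R]_n :=
  Q + K^T *m S *m K.

(* [value_mx] and [covariance_mx] are the solutions of the two Lyapunov
   equations. These are unique when the closed loop has spectral radius < 1;
   [xget 0] selects some solution, or 0 if there is none, for the other gains. *)
Definition value_mx (R : realType) (n m : nat)
    (A : 'M[R]_n) (B : 'M[R]_(n, m)) (Q : 'M[R]_n) (S : 'M[R]_m)
    (K : 'M[R]_(m, n)) : 'M[R]_n :=
  xget 0 [set P | P = stage_cost Q S K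
                      + (closed_loop A B K)^T *m P *m closed_loop A B K].

Definition covariance_mx (R : realType) (n m : nat)
    (A : 'M[R]_n) (B : 'M[R]_(n, m)) (K : 'M[R]_(m, n)) : 'M[R]_n :=
  xget 0 [set X | X = 1%:M + closed_loop A B K *m X *m (closed_loop A B K)^T].

(* Only meaningful on [jointly_stabilizing A B]. This set is open, so the
   derivatives at its points do not depend on the values outside. *)
Definition sample_average_cost (R : realType) (M n m : nat)
    (A : 'I_M -> 'M[R]_n) (B : 'I_M -> 'M[R]_(n, m))
    (Q : 'M[R]_n) (S : 'M[R]_m) (K : 'M[R]_(m, n)) : R :=
  M%:R^-1 *
  \sum_(j < M) \tr (stage_cost Q S K *m covariance_mx (A j) (B j) K).

Definition stabilizing_sublevel (R : realType) (M n m : nat)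
    (A : 'I_M -> 'M[R]_n) (B : 'I_M -> 'M[R]_(n, m))
    (Q : 'M[R]_n) (S : 'M[R]_m) (gamma : R) : set 'M[R]_(m, n) :=
  [set K | jointly_stabilizing A B K /\
           sample_average_cost A B Q S K <= gamma].

(* The solution of this linear equation is unique when K is jointly stabilizing,
   Q is positive semidefinite, S is positive definite and M > 0. *)
Definition improved_gain (R : realType) (M n m : nat)
    (A : 'I_M -> 'M[R]_n) (B : 'I_M -> 'M[R]_(n, m))
    (Q : 'M[R]_n) (S : 'M[R]_m) (K : 'M[R]_(m, n)) : 'M[R]_(m, n) :=
  xget 0 [set K' |
    \sum_(j < M)
      ((S + (B j)^T *m value_mx (A j) (B j) Q S K *m B j) *m K'
       + (B j)^T *m value_mx (A j) (B j) Q S K *m A j)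
      *m covariance_mx (A j) (B j) K = 0].

Definition update_direction (R : realType) (M n m : nat)
    (A : 'I_M -> 'M[R]_n) (B : 'I_M -> 'M[R]_(n, m))
    (Q : 'M[R]_n) (S : 'M[R]_m) (K : 'M[R]_(m, n)) : 'M[R]_(m, n) :=
  improved_gain A B Q S K - K.

Definition policy_iterates (R : realType) (M n m : nat)
    (A : 'I_M -> 'M[R]_n) (B : 'I_M -> 'M[R]_(n, m))
    (Q : 'M[R]_n) (S : 'M[R]_m) (K : nat -> 'M[R]_(m, n)) : Prop :=
  forall i, exists2 a : R, 0 < a &
    K i.+1 = K i + a *: update_direction A B Q S (K i).

(* Main.v *)
(* Put phi t = f (K + t v), where K lies in the sublevel set D and f is L-smooth
   only on D. Wherever K + t v lies in D and t < c / L, Cauchy-Schwarz gives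
   phi' t <= (L t - c) |v|^2 < 0. Hence the segment cannot leave D before
   t = c / L: at the last time T up to which it stays in D, the point is still
   in D because D is closed, and phi' T < 0 keeps phi below its level just
   after T. So phi is strictly decreasing on the whole step. *)

Require Import Defs.
From mathcomp Require Import all_boot all_order all_algebra.
From mathcomp Require Import all_classical all_reals all_analysis.
From mathcomp Require Import lra.

Import Order.TTheory GRing.Theory Num.Theory.
Import numFieldNormedType.Exports.

Local Open Scope classical_set_scope.
Local Open Scope ring_scope.

(** * The Frobenius inner product and norm *)

Lemma frobenius_dotE (R : realType) m n (X Y : 'M[R]_(m, n)) :
  frobenius_dot X Y = \sum_i \sum_j X i j * Y i j.
Proof.
rewrite /frobenius_dot /mxtrace exchange_big; apply: eq_bigr => j _.
by rewrite mxE; apply: eq_bigr => i _; rewrite mxE.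
Qed.

Lemma frobenius_dotC (R : realType) m n (X Y : 'M[R]_(m, n)) :
  frobenius_dot X Y = frobenius_dot Y X.
Proof.
by rewrite !frobenius_dotE; do 2 (apply: eq_bigr => ? _); rewrite mulrC.
Qed.

Lemma frobenius_dotBl (R : realType) m n (X Y Z : 'M[R]_(m, n)) :
  frobenius_dot (X - Y) Z = frobenius_dot X Z - frobenius_dot Y Z.
Proof. by rewrite /frobenius_dot linearB mulmxBl linearB. Qed.

Lemma frobenius_dotZl (R : realType) m n a (X Y : 'M[R]_(m, n)) :
  frobenius_dot (a *: X) Y = a * frobenius_dot X Y.
Proof. by rewrite /frobenius_dot linearZ -scalemxAl linearZ. Qed.

Lemma frobenius_dot_ge0 (R : realType) m n (X : 'M[R]_(m, n)) :
  0 <= frobenius_dot X X.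
Proof.
by rewrite frobenius_dotE; do 2 (apply: sumr_ge0 => ? _); rewrite -expr2 sqr_ge0.
Qed.

Lemma frobenius_dot_eq0 (R : realType) m n (X : 'M[R]_(m, n)) :
  (frobenius_dot X X == 0) = (X == 0).
Proof.
apply/idP/eqP => [|->]; last by rewrite /frobenius_dot mulmx0 mxtrace0.
rewrite frobenius_dotE psumr_eq0 => [|i _]; last first.
  by apply: sumr_ge0 => j _; rewrite -expr2 sqr_ge0.
move=> /allP X0; apply/matrixP => i j; rewrite mxE.
have := X0 i (mem_index_enum i); rewrite psumr_eq0 => [|k _]; last first.
  by rewrite -expr2 sqr_ge0.
by move=> /allP/(_ j (mem_index_enum j)); rewrite mulf_eq0 orbb => /eqP.
Qed.

Lemma sqr_frobenius_norm (R : realType) m n (X : 'M[R]_(m, n)) :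
  frobenius_norm X ^+ 2 = frobenius_dot X X.
Proof. by rewrite sqr_sqrtr// frobenius_dot_ge0. Qed.

Lemma frobenius_norm_gt0 (R : realType) m n (X : 'M[R]_(m, n)) :
  (0 < frobenius_norm X) = (X != 0).
Proof. by rewrite sqrtr_gt0 lt0r frobenius_dot_eq0 frobenius_dot_ge0 andbT. Qed.

Lemma frobenius_normZ (R : realType) m n a (X : 'M[R]_(m, n)) :
  frobenius_norm (a *: X) = `|a| * frobenius_norm X.
Proof.
rewrite /frobenius_norm frobenius_dotZl frobenius_dotC frobenius_dotZl mulrA.
by rewrite -expr2 sqrtrM ?sqr_ge0// sqrtr_sqr.
Qed.

Lemma frobenius_CauchySchwarz (R : realType) m n (X Y : 'M[R]_(m, n)) :
  frobenius_dot X Y <= frobenius_norm X * frobenius_norm Y.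
Proof.
have [->|X0] := eqVneq X 0.
  by rewrite frobenius_dotE big1 ?mulr_ge0 ?sqrtr_ge0// => i _;
    rewrite big1// => j _; rewrite mxE mul0r.
have [->|Y0] := eqVneq Y 0.
  by rewrite frobenius_dotC frobenius_dotE big1 ?mulr_ge0 ?sqrtr_ge0// => i _;
    rewrite big1// => j _; rewrite mxE mul0r.
set x := frobenius_norm X; set y := frobenius_norm Y.
have x0 : 0 < x by rewrite frobenius_norm_gt0.
have y0 : 0 < y by rewrite frobenius_norm_gt0.
(* The square of the norm of [y *: X - x *: Y] expands to 2 x y (x y - d). The zero matrices were
   split off so that the positive factor x y can be cancelled. *)
have := frobenius_dot_ge0 _ _ _ (y *: X - x *: Y).
rewrite frobenius_dotBl !frobenius_dotZl.
rewrite ![frobenius_dot _ (_ - _)]frobenius_dotC !frobenius_dotBl.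
rewrite !frobenius_dotZl (frobenius_dotC _ _ _ Y X) -!sqr_frobenius_norm -/x -/y.
set d := frobenius_dot X Y => le0.
have : 0 <= (x * y) * (x * y - d) by lra.
by rewrite pmulr_rge0 ?mulr_gt0// subr_ge0.
Qed.

(** * Directional derivatives and derivatives along a line *)

Lemma derive_gradient (R : realType) m n (f : 'M[R]_(m, n) -> R) K v :
  differentiable f K -> 'D_v f K = frobenius_dot (gradient f K) v.
Proof.
(* The differential is linear, hence determined by its values on the [delta_mx i j], which are the
   entries of the gradient. *)
move=> df; rewrite deriveE// {1}(matrix_sum_delta v) linear_sum frobenius_dotE.
apply: eq_bigr => i _; rewrite linear_sum; apply: eq_bigr => j _.
by rewrite linearZ mxE deriveE// mulrC.
Qed.

Lemma is_derive_line (R : realType) (V : normedModType R) (f : V -> R) x v t :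
  differentiable f (x + t *: v) ->
  is_derive t 1 (fun s : R => f (x + s *: v)) ('D_v f (x + t *: v)).
Proof.
move=> df.
(* The difference quotient of the restriction to the line at t is, as a function of h, that of f at
   [x + t *: v] along v, so no chain rule is involved. *)
have eqd : (fun h : R => h^-1 *: (((fun s : R => f (x + s *: v)) \o shift t) (h *: 1)
      - f (x + t *: v))) =
    (fun h : R => h^-1 *: ((f \o shift (x + t *: v)) (h *: v) - f (x + t *: v))).
  apply/funext => h /=; rewrite [h *: 1]mulr1 scalerDl.
  by rewrite addrCA.
have dv : derivable f (x + t *: v) v by exact: diff_derivable.
split; first by rewrite /derivable eqd; exact: dv.
by rewrite /derive eqd.
Qed.

(** * Descent of a real function below a level *)

Lemma derive1_lt0_near (R : realType) (phi : R -> R) (t : R) :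
  derivable phi t 1 -> phi^`()%classic t < 0 ->
  \forall s \near t^'+, phi s < phi t.
Proof.
move=> dphi; rewrite derive1E => phi0.
have := cvgr_lt _ dphi _ phi0.
move=> [e /= e0 He].
exists e => //= s ts st.
have := He (s - t); rewrite /= /ball /= sub0r normrN -normrN opprB.
move=> /(_ ts); rewrite subr_eq0 gt_eqF// => /(_ isT).
rewrite [(s - t) *: 1]mulr1 subrK.
by rewrite pmulr_rlt0 ?invr_gt0 ?subr_gt0// subr_lt0.
Qed.

(** A continuation argument. Nothing is known about phi where it exceeds gam, so closedness of the
    set of good times stands in for continuity. The sign condition leaves out t = a, where the later
    bound on the derivative may degenerate to 0. *)
Lemma descent_in_sublevel (R : realType) (phi : R -> R) (a gam : R) :
  0 < a -> phi 0 <= gam ->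
  closed [set t | 0 <= t <= a /\ phi t <= gam] ->
  (forall t, 0 <= t <= a -> phi t <= gam -> derivable phi t 1) ->
  (forall t, 0 <= t < a -> phi t <= gam -> phi^`()%classic t < 0) ->
  phi a < phi 0.
Proof.
move=> a0 phi0 clS dphi phi'0.
set S := [set t | _] in clS.
(* The set S may have gaps, so T is the supremum of the times before which no gap occurs. It belongs
   to S because S is closed and contains E. *)
pose E := [set t | 0 <= t <= a /\ forall s, 0 <= s <= t -> phi s <= gam].
have ES : E `<=` S.
  by move=> t [tab Et]; split=> //; apply: Et; case/andP: tab => -> _ /=.
have E0 : E 0.
  by split=> [|s]; [rewrite lexx ltW|rewrite -eq_le => /eqP <-].
have ubE : has_ubound E by exists a => t [/andP[]].
pose T := sup E.
have [/andP[T0 Ta] phiT] : S T.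
  by apply: clS; apply: (closure_subset ES); apply: closure_sup => //; exists 0.
have below s : 0 <= s <= T -> phi s <= gam.
  move=> /andP[s0]; rewrite le_eqVlt => /predU1P[->//|sT].
  have [|t [_ Et] st] := @sup_adherent _ E (T - s) _ (conj (ex_intro _ 0 E0) ubE).
    by rewrite subr_gt0.
  by apply: Et; rewrite s0 ltW//; move: st; rewrite -/T subKr.
have aT : a <= T.
  rewrite leNgt; apply/negP => Tlta.
  have T0a : 0 <= T <= a by rewrite T0.
  have Tlt : 0 <= T < a by rewrite T0.
  (* If T < a, the strict decrease just after T puts some u > T into E. Halving e keeps the closed
     interval from T to u inside the open ball of radius e, and the minimum keeps u at most a. *)
  have := derive1_lt0_near _ _ _ (dphi T T0a phiT) (phi'0 T Tlt phiT).
  move=> [e /= e0 He].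
  pose u := Num.min (T + e / 2) a.
  have Tu : T < u by rewrite lt_min Tlta andbT ltrDl divr_gt0.
  suff /(ub_le_sup ubE) : E u by rewrite -/T leNgt Tu.
  split; first by rewrite (le_trans T0 (ltW Tu)) ge_min lexx orbT.
  move=> s /andP[s0 su]; have [sT|Ts] := leP s T; first by rewrite below ?s0.
  apply: (le_trans (ltW (He s _ Ts))) => //=.
  rewrite /ball_ /= distrC gtr0_norm ?subr_gt0//.
  have : s <= T + e / 2 by rewrite (le_trans su)// ge_min lexx.
  lra.
have below_a s : 0 <= s <= a -> phi s <= gam.
  by move=> /andP[s0 sa]; rewrite below// s0 (le_trans sa).
apply: (@ltr0_derive1_lt_cc _ phi 0 a); rewrite ?in_itv/= ?lexx ?ltW//.
- move=> s; rewrite in_itv/= => /andP[s0 sa].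
  by apply: dphi; [|apply: below_a]; rewrite !ltW.
- move=> s; rewrite in_itv/= => /andP[s0 sa].
  by apply: phi'0; [|apply: below_a]; rewrite ?sa !ltW.
- apply: derivable_within_continuous => s; rewrite in_itv/= => s0a.
  by apply: dphi => //; apply: below_a.
Qed.

(** The set X plays the role of the stabilizing gains, outside which the values of f mean nothing.
    The segment is therefore assumed to stay in X, while its staying below gam is part of what is
    proved. *)
Lemma sublevel_line_search (R : realType) (m n : nat) (f : 'M[R]_(m, n) -> R)
    (X : set 'M[R]_(m, n)) (gam L c a : R) (K v : 'M[R]_(m, n)) :
  let D := [set K' | X K' /\ f K' <= gam] in
  closed D -> (forall K', D K' -> differentiable f K') ->
  0 < L -> smooth_on L f D -> D K -> v != 0 ->
  (forall t, 0 <= t <= a -> X (K + t *: v)) ->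
  frobenius_dot (gradient f K) v <= - c * frobenius_norm v ^+ 2 ->
  0 < a <= c / L ->
  f (K + a *: v) < f K.
Proof.
move=> D clD df L0 smf DK v0 Xv desc /andP[a0 acL].
pose phi t := f (K + t *: v).
have dphi t : D (K + t *: v) ->
    is_derive t 1 phi (frobenius_dot (gradient f (K + t *: v)) v).
  move=> /df dfK; rewrite -derive_gradient//; exact: is_derive_line.
have -> : f K = phi 0 by rewrite /phi scale0r addr0.
apply: (descent_in_sublevel _ phi a gam) => //.
- by rewrite /phi scale0r addr0; case: DK.
(* As the segment lies in X, the good times are those in [0, a] that the continuous map to the line
   sends into the closed set D. *)
- have -> : [set t | 0 <= t <= a /\ phi t <= gam] =
      `[0, a] `&` (fun t : R => K + t *: v) @^-1` D.
    apply/seteqP; split=> t /=; rewrite in_itv/=.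
      by move=> [t0a phit]; split=> //; split=> //; apply: Xv.
    by move=> [t0a [_ phit]].
  apply: closedI; first exact: interval_closed.
  apply: preimage_closed => // t _; apply: cvgD; first exact: cvg_cst.
  exact: scalel_continuous.
- move=> t t0a phit.
  by have [] := dphi t (conj (Xv t t0a) phit).
move=> t /andP[t0 ta] phit.
have Dt : D (K + t *: v) by split=> //; apply: Xv; rewrite t0 ltW.
have ? := dphi t Dt; rewrite derive1E derive_val.
have vpos : 0 < frobenius_norm v by rewrite frobenius_norm_gt0.
have Ltc : L * t < c.
  by rewrite mulrC -ltr_pdivlMr// (lt_le_trans ta).
(* The gradient at [K + t *: v] is compared with the one at K. Smoothness is applied to these two
   points of D only, so D need not be convex. *)
have := frobenius_CauchySchwarz _ _ _ (gradient f (K + t *: v) - gradient f K) v.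
rewrite frobenius_dotBl lerBlDr => /le_lt_trans; apply.
have := smf _ _ Dt DK.
rewrite (addrC K) addrK frobenius_normZ ger0_norm// (addrC _ K) => smt.
have := ler_wpM2r (ltW vpos) smt.
have : 0 < (c - L * t) * frobenius_norm v ^+ 2.
  by rewrite mulr_gt0 ?subr_gt0 ?exprn_gt0.
lra.
Qed.

Theorem theorem3 (R : realType) (M n m : nat)
    (A : 'I_M -> 'M[R]_n) (B : 'I_M -> 'M[R]_(n, m))
    (Q : 'M[R]_n) (S : 'M[R]_m) (gamma L abar cd : R)
    (K : nat -> 'M[R]_(m, n)) :
  (1 <= M)%N ->
  possemidef Q ->
  posdef S ->
  jointly_stabilizing A B !=set0 ->
  compact (stabilizing_sublevel A B Q S gamma) ->
  continuously_differentiable_on (sample_average_cost A B Q S)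
    (stabilizing_sublevel A B Q S gamma) ->
  0 < L ->
  smooth_on L (sample_average_cost A B Q S)
    (stabilizing_sublevel A B Q S gamma) ->
  policy_iterates A B Q S K ->
  (forall i, stabilizing_sublevel A B Q S gamma (K i)) ->
  (ereal_sup (range (fun i =>
     (frobenius_norm (update_direction A B Q S (K i)))%:E)) < +oo)%E ->
  0 < abar ->
  (forall (i : nat) (a : R), 0 <= a <= abar ->
     jointly_stabilizing A B (K i + a *: update_direction A B Q S (K i))) ->
  0 < cd ->
  (forall i, frobenius_dot (gradient (sample_average_cost A B Q S) (K i))
       (update_direction A B Q S (K i))
     <= - cd * frobenius_norm (update_direction A B Q S (K i)) ^+ 2) ->
  forall (i : nat) (alpha : R),
    update_direction A B Q S (K i) != 0 ->
    0 < alpha <= Num.min abar (cd / L) ->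
    sample_average_cost A B Q S (K i + alpha *: update_direction A B Q S (K i))
    < sample_average_cost A B Q S (K i).
Proof.
move=> _ _ _ _ cptD [df _] L0 smf _ DK _ _ stab _ desc i alpha v0.
rewrite le_min => /and3P[alpha0 alphab alphaL].
(* The bound by [abar] keeps the segment stabilizing, and the bound by [cd / L] gives the descent.
   The sublevel set is closed because it is compact in a Hausdorff space. *)
apply: (sublevel_line_search _ _ _ _ (jointly_stabilizing A B)
          gamma L cd alpha) => //.
- exact: compact_closed (@norm_hausdorff _ _) cptD.
- exact: DK.
- by move=> t /andP[t0 ta]; apply: stab; rewrite t0 (le_trans ta).
- by rewrite alpha0.
Qed.
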